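(* Let $p\in[1,\infty]$ and let $\mathcal{I}$ be one of the operator ideals $\mathcal{K}_p$ ($p$-compact operators), $\mathcal{K}_{wp}$ (weakly $p$-compact operators) or $\mathcal{K}_{up}$ (unconditionally $p$-compact operators). Then $$[\mathcal{I}^{-1}\circ\mathcal{H}_{v\mathcal{I}}^\infty,\|\cdot\|_{\mathcal{I}^{-1}\circ\mathcal{H}_{v\mathcal{I}}^\infty}]=[\mathcal{H}_v^\infty,\|\cdot\|_v].$$ That is, for every open subset $U$ of a complex Banach space, every weight $v$ on $U$, every complex Banach space $F$ and every $f\in\mathcal{H}_v^\infty(U,F)$, one has $A\circ f\in\mathcal{H}_{v\mathcal{I}}^\infty(U,G)$ for every complex Banach space $G$ and every $A\in\mathcal{I}(F,G)$, and $\|f\|_{\mathcal{I}^{-1}\circ\mathcal{H}_{v\mathcal{I}}^\infty}=\|f\|_v$.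
   Context: All Banach spaces are complex. A weight $v$ on an open subset $U$ of a Banach space is a strictly positive continuous function on $U$. $\mathcal{H}_v^\infty(U,F)$ is the Banach space of holomorphic $f:U\to F$ with $\|f\|_v:=\sup_{x\in U}v(x)\|f(x)\|<\infty$. Write $(vf)(U)=\{v(x)f(x):x\in U\}$. Let $1/p+1/p^*=1$ (with $1^*=\infty$, $\infty^*=1$). For a sequence $(x_n)$ in $F$, $p\text{-conv}(x_n):=\{\sum_n a_nx_n:\|(a_n)\|_{\ell_{p^*}}\le1\}$ (the set of those sums whose series converges in norm). Consider three types of sequences in $F$: type $i=p$: $p$-summable sequences (norm-null sequences if $p=\infty$), with $\|(x_n)\|_i=(\sum\|x_n\|^p)^{1/p}$ (sup if $p=\infty$); type $i=wp$: weakly $p$-summable sequences (weakly null sequences if $p=\infty$), with $\|(x_n)\|_i=\sup_{\varphi\in B_{F^*}}(\sum|\varphi(x_n)|^p)^{1/p}$ ($\sup_n\|x_n\|$ if $p=\infty$); type $i=up$: unconditionally $p$-summable sequences, i.e. weakly $p$-summable sequences whose tails $(x_n)_{n\ge m}$ tend to $0$ in the weak $p$-norm as $m\to\infty$ (norm-null sequences if $p=\infty$), with the same norm as for $wp$. A set $K\subset F$ is relatively $p$-compact, relatively weakly $p$-compact, or relatively unconditionally $p$-compact if $K\subset p\text{-conv}(x_n)$ for some sequence of type $p$, $wp$, $up$, respectively. For $i=p,wp,up$, $\mathcal{K}_i(F,G)$ is the set of $T\in\mathcal{L}(F,G)$ such that $T(B_F)\subset p\text{-conv}(x_n)$ for some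 sequence $(x_n)$ in $G$ of type $i$, with norm $\|T\|_{\mathcal{K}_i}=\inf\|(x_n)\|_i$ over all such sequences. $\mathcal{H}_{v\mathcal{K}_i}^\infty(U,F)$ is the set of $f\in\mathcal{H}_v^\infty(U,F)$ such that $(vf)(U)\subset p\text{-conv}(x_n)$ for some sequence of type $i$ in $F$, with norm $\|f\|_{\mathcal{H}_{v\mathcal{K}_i}^\infty}=\inf\|(x_n)\|_i$ over all such sequences. The left-hand quotient $\mathcal{I}^{-1}\circ\mathcal{H}_{v\mathcal{I}}^\infty(U,F)$ is the set of $f\in\mathcal{H}_v^\infty(U,F)$ such that $A\circ f\in\mathcal{H}_{v\mathcal{I}}^\infty(U,G)$ for every Banach space $G$ and every $A\in\mathcal{I}(F,G)$, with norm $\sup\{\|A\circ f\|_{\mathcal{H}_{v\mathcal{I}}^\infty}:A\in\mathcal{I}(F,G),\ \|A\|_{\mathcal{I}}\le1\}$, $G$ ranging over all Banach spaces. *)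

(* Defs.v *)
From HB Require Import structures.
From mathcomp Require Import all_boot all_order all_algebra.
From mathcomp Require Import all_classical all_reals all_analysis.
From mathcomp Require Import complex.

Set Implicit Arguments.
Unset Strict Implicit.
Unset Printing Implicit Defensive.
Import Order.TTheory GRing.Theory Num.Theory.
Import numFieldNormedType.Exports.
Local Open Scope classical_set_scope.
Local Open Scope ring_scope.
Local Open Scope complex_scope.

(* In MathComp-Analysis the norm of a normed module over R[i] is R[i]-valued
   (with real nonnegative values). *)
Definition rnorm (R : realType) (V : normedZmodType R[i]) (x : V) : R :=
  complex.Re `|x|.

(* For p = +oo the essential supremum with respect to counting is sup_n |a_n|. *)
Definition lpnorm (R : realType) (p : \bar R) (a : nat -> R) : \bar R :=
  Lnorm (@counting _ R) p (EFin \o a).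

(* The kinds of sequences in p-convex hulls that define, respectively, the
   operator ideals K_p, K_wp and K_up. *)
Inductive seq_kind := StrongSeq | WeakSeq | UncondSeq.

Section sequences.
Context {R : realType}.
Implicit Types (p : \bar R) (i : seq_kind).

Definition unit_ball (F : normedModType R[i]) : set F :=
  [set x | rnorm x <= 1].
Arguments unit_ball : clear implicits.

Definition dual (F : normedModType R[i]) : set {linear F -> R[i]^o} :=
  [set phi | continuous phi].
Arguments dual : clear implicits.

Definition dual_ball (F : normedModType R[i]) : set {linear F -> R[i]^o} :=
  [set phi | dual F phi /\ forall x, unit_ball F x -> rnorm (phi x) <= 1].
Arguments dual_ball : clear implicits.

Definition strong_norm (F : normedModType R[i]) p (x : nat -> F) : \bar R :=
  lpnorm p (fun n => rnorm (x n)).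

Definition weak_norm (F : normedModType R[i]) p (x : nat -> F) : \bar R :=
  if p == +oo%E then ereal_sup [set (rnorm (x n))%:E | n in [set: nat]]
  else ereal_sup
    [set lpnorm p (fun n => rnorm (phi (x n))) | phi in dual_ball F].

Definition seq_norm (F : normedModType R[i]) p i (x : nat -> F) : \bar R :=
  match i with
  | StrongSeq => strong_norm p x
  | WeakSeq | UncondSeq => weak_norm p x
  end.

Definition strong_seq (F : normedModType R[i]) p (x : nat -> F) : Prop :=
  if p == +oo%E then x @ \oo --> (0 : F) else (strong_norm p x < +oo)%E.

Definition weak_seq (F : normedModType R[i]) p (x : nat -> F) : Prop :=
  forall phi : {linear F -> R[i]^o}, dual F phi ->
    if p == +oo%E then (fun n => phi (x n)) @ \oo --> (0 : R[i]^o)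
    else (lpnorm p (fun n => rnorm (phi (x n))) < +oo)%E.

Definition uncond_seq (F : normedModType R[i]) p (x : nat -> F) : Prop :=
  if p == +oo%E then x @ \oo --> (0 : F)
  else weak_seq p x /\
    (fun m => weak_norm p (fun n => x (m + n)%N)) @ \oo --> 0%E.

Definition seq_of_kind (F : normedModType R[i]) p i (x : nat -> F) : Prop :=
  match i with
  | StrongSeq => strong_seq p x
  | WeakSeq => weak_seq p x
  | UncondSeq => uncond_seq p x
  end.

(* hoelder_conjugate sends 1 to +oo and +oo to 1. For p = 1 the series need not
   converge for every a; only the sums of convergent ones are kept. *)
Definition pconv (F : normedModType R[i]) p (x : nat -> F) : set F :=
  [set y | exists2 a : nat -> R[i],
    (lpnorm (hoelder_conjugate p) (fun n => rnorm (a n)) <= 1)%E &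
    series (fun n => a n *: x n) @ \oo --> y].

Definition hull_seqs (F : normedModType R[i]) p i (K : set F) :
    set (nat -> F) :=
  [set x | seq_of_kind p i x /\ K `<=` pconv p x].

Definition hull_norm (F : normedModType R[i]) p i (K : set F) : \bar R :=
  ereal_inf [set seq_norm p i x | x in hull_seqs p i K].

Definition rel_compact (F : normedModType R[i]) p i (K : set F) : Prop :=
  exists x, hull_seqs p i K x.

Definition compact_op (F G : normedModType R[i]) p i : set {linear F -> G} :=
  [set T | continuous T /\ rel_compact p i (T @` unit_ball F)].

Definition compact_op_norm (F G : normedModType R[i]) p i
    (T : {linear F -> G}) : \bar R :=
  hull_norm p i (T @` unit_ball F).

End sequences.

Section weighted.
Context {R : realType} {E : completeNormedModType R[i]}.
Variables (U : set E) (v : E -> R).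
Implicit Types (p : \bar R) (i : seq_kind) (F G : completeNormedModType R[i]).

Definition weight : Prop :=
  {within U, continuous v} /\ forall x, U x -> 0 < v x.

(* 0 is added so that the supremum is 0, not -oo, when U is empty. *)
Definition Hv_norm F (f : E -> F) : \bar R :=
  ereal_sup (0%E |` [set (v x * rnorm (f x))%:E | x in U]).

(* Maps U -> F are represented by total maps E -> F; no notion below depends
   on the values outside of the open set U. Differentiability is Frechet
   differentiability over R[i]. *)
Definition Hv F : set (E -> F) :=
  [set f | (forall x, U x -> differentiable f x) /\ (Hv_norm f < +oo)%E].
Arguments Hv {F}.

Definition weighted_image F (f : E -> F) : set F :=
  [set (v x)%:C *: f x | x in U].

Definition HvK F p i : set (E -> F) :=
  [set f | Hv f /\ rel_compact p i (weighted_image f)].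
Arguments HvK {F}.

Definition HvK_norm F p i (f : E -> F) : \bar R :=
  hull_norm p i (weighted_image f).

Definition quotient_Hv F p i : set (E -> F) :=
  [set f | Hv f /\
    forall G (A : {linear F -> G}), compact_op p i A -> HvK p i (A \o f)].

Definition quotient_norm F p i (f : E -> F) : \bar R :=
  ereal_sup [set r | exists G (A : {linear F -> G}),
    [/\ compact_op p i A, (compact_op_norm p i A <= 1)%E
      & r = HvK_norm p i (A \o f)]].

End weighted.

Arguments Hv {R E} U v {F}.
Arguments HvK {R E} U v {F} p i.
Arguments quotient_Hv {R E} U v {F} p i.

(* Main.v *)
(* Upper bound: if ||f||_v <= c and c > 0, the image (v f)(U) lies in c B_F, so
   (v (A o f))(U) lies in c A(B_F), and a sequence x whose p-convex hull contains
   A(B_F) gives the sequence c x for A o f; let c decrease to ||f||_v.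
   Lower bound: for x in U let phi in B_{F*} norm f(x) and take the rank-one
   operator A = phi(.) u on F with u = f(x) / ||f(x)||.  It maps B_F into the
   p-convex hull of (u, 0, 0, ...), so ||A|| <= 1, while
   phi(v(x) A(f(x))) = v(x) ||f(x)|| and, by Hoelder's inequality, phi is bounded
   on the p-convex hull of (x_n) by the weak p-norm of (x_n).
   The norming functional comes from Zorn's lemma applied to the sublinear
   functionals below the norm: a minimal one is additive. *)

Require Import Defs.
From HB Require Import structures.
From mathcomp Require Import all_boot all_order all_algebra.
From mathcomp Require Import all_classical all_reals all_analysis.
From mathcomp Require Import ess_sup_inf complex.
From mathcomp Require Import ring lra.

Set Implicit Arguments.
Unset Strict Implicit.
Unset Printing Implicit Defensive.
Import Order.TTheory GRing.Theory Num.Theory.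
Import numFieldNormedType.Exports.
Local Open Scope classical_set_scope.
Local Open Scope ring_scope.
Local Open Scope complex_scope.

(** * Sublinear functionals and the Hahn-Banach theorem *)

Definition sublinear (R : realType) (V : lmodType R[i]) (q : V -> R) : Prop :=
  (forall x y, q (x + y) <= q x + q y) /\
  (forall (t : R) x, 0 <= t -> q (t%:C *: x) = t * q x).

Lemma sublinear0 (R : realType) (V : lmodType R[i]) (q : V -> R) :
  sublinear q -> q 0 = 0.
Proof. by case=> _ /(_ 0 0 (lexx _)); rewrite scaler0 mul0r. Qed.

Lemma sublinear_ge (R : realType) (V : lmodType R[i]) (q : V -> R) x :
  sublinear q -> - q (- x) <= q x.
Proof.
move=> sq; have := sq.1 x (- x).
by rewrite subrr sublinear0 // -lerBlDr sub0r.
Qed.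

(** Only an upper estimate for positive factors is asked for: applying it to [t^-1] and [t x] gives
    the reverse inequality. This suits functionals defined as infima. *)
Lemma sublinearP (R : realType) (V : lmodType R[i]) (q : V -> R) :
  (forall x y, q (x + y) <= q x + q y) -> q 0 = 0 ->
  (forall (t : R) x, 0 < t -> q (t%:C *: x) <= t * q x) -> sublinear q.
Proof.
move=> qD q0 qZ; split=> // t x; rewrite le_eqVlt => /predU1P[<-|t0].
  by rewrite scale0r q0 mul0r.
apply/le_anti/andP; split; first exact: qZ.
have ti0 : 0 < t^-1 by rewrite invr_gt0.
have := qZ _ (t%:C *: x) ti0; rewrite scalerA -rmorphM mulVf ?gt_eqF //.
by rewrite scale1r ler_pdivlMl.
Qed.

(* Minimising over translations along [x0] makes [q'] linear on the line through
   [x0]. *)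
Lemma sublinear_shift (R : realType) (V : lmodType R[i]) (q : V -> R) (x0 : V) :
  sublinear q -> exists q' : V -> R,
    [/\ sublinear q', (forall x, q' x <= q x) & q' (- x0) <= - q x0].
Proof.
move=> sq; have [qD qZ] := sq.
(* The new functional is $q'(x) = \inf_{t \ge 0} (q(x + t x_0) - t q(x_0))$. The choice $t = 0$
   gives $q' \le q$, and $t = 1$ at $-x_0$ gives the last claim. *)
pose S x := [set q (x + t%:C *: x0) - t * q x0 | t in [set t : R | 0 <= t]].
have S0 x : S x !=set0.
  by exists (q (x + (0 : R)%:C *: x0) - 0 * q x0); exists 0 => /=.
(* The infimum is finite, since $t q(x_0) = q(t x_0) \le q(x + t x_0) + q(-x)$. *)
have Slb x : lbound (S x) (- q (- x)).
  move=> _ [t /= t0 <-]; rewrite -qZ // lerBrDr addrC -lerBrDr opprK.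
  have := qD (x + t%:C *: x0) (- x); by rewrite addrAC subrr add0r.
have Sinf x a : S x a -> inf (S x) <= a.
  by apply: ge_inf; exists (- q (- x)).
have lbinf x a : lbound (S x) a -> a <= inf (S x) by apply: lb_le_inf.
exists (fun x => inf (S x)); split.
- apply: sublinearP.
  + move=> x y; rewrite -lerBlDr; apply: (lbinf) => _ [s /= s0 <-].
    rewrite lerBlDr [leRHS]addrC -lerBlDr; apply: (lbinf) => _ [t /= t0 <-].
    rewrite lerBlDr; apply: le_trans.
      by apply: (Sinf); exists (s + t) => //=; exact: addr_ge0.
    have := qD (x + s%:C *: x0) (y + t%:C *: x0).
    by rewrite addrACA -scalerDl -rmorphD mulrDl => /= h; lra.
  + apply/le_anti/andP; split.
      apply: (Sinf); exists 0 => //=.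
      by rewrite scale0r addr0 sublinear0 // mul0r subr0.
    by apply: (lbinf) => _ [t /= t0 <-]; rewrite add0r qZ // subrr.
  + move=> t x t0; rewrite mulrC -ler_pdivrMr //.
    apply: (lbinf) => _ [s /= s0 <-].
    rewrite ler_pdivrMr //; apply: (Sinf); exists (t * s) => /=.
      by rewrite mulr_ge0 // ltW.
    by rewrite rmorphM -scalerA -scalerDr qZ ?ltW //; ring.
- by move=> x; apply: (Sinf); exists 0 => //=; rewrite scale0r addr0 mul0r subr0.
- apply: (Sinf); exists 1 => //=.
  by rewrite scale1r addNr sublinear0 // mul1r sub0r.
Qed.

(** The pointwise infimum works. It is finite because every member lies above [- p (- x)] for one
    fixed [p] in the chain, and subadditive because, of two members used at [x] and [y], the smaller
    can replace the other. This is the chain condition for Zorn's lemma. *)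
Lemma sublinear_chain_inf (R : realType) (V : lmodType R[i])
    (A : set (V -> R)) :
  (forall q, A q -> sublinear q) -> A !=set0 ->
  (forall q r, A q -> A r -> (forall x, q x <= r x) \/ (forall x, r x <= q x)) ->
  exists2 q0 : V -> R, sublinear q0 & forall q, A q -> forall x, q0 x <= q x.
Proof.
move=> Asub [p Ap] Atot.
pose S x := [set q x | q in A].
have S0 x : S x !=set0 by exists (p x), p.
have Slb x : lbound (S x) (- p (- x)).
  move=> _ [q Aq <-]; case: (Atot _ _ Ap Aq) => h.
    by rewrite (le_trans _ (h x)) // sublinear_ge //; exact: Asub.
  by rewrite (le_trans _ (sublinear_ge x (Asub _ Aq))) // lerN2.
have Sinf x a : S x a -> inf (S x) <= a.
  by apply: ge_inf; exists (- p (- x)).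
have lbinf x a : lbound (S x) a -> a <= inf (S x) by apply: lb_le_inf.
exists (fun x => inf (S x)); last by move=> q Aq x; apply: (Sinf); exists q.
apply: sublinearP.
- move=> x y; rewrite -lerBlDr; apply: (lbinf) => _ [q Aq <-].
  rewrite lerBlDr [leRHS]addrC -lerBlDr; apply: (lbinf) => _ [r Ar <-].
  rewrite lerBlDr.
  case: (Atot _ _ Aq Ar) => h.
    apply: (@le_trans _ _ (q (x + y))); first by apply: (Sinf); exists q.
    by have := (Asub _ Aq).1 x y; have := h y; lra.
  apply: (@le_trans _ _ (r (x + y))); first by apply: (Sinf); exists r.
  by have := (Asub _ Ar).1 x y; have := h x; lra.
- apply/le_anti/andP; split.
    by apply: (Sinf); exists p => //; apply: sublinear0; exact: Asub.
  by apply: (lbinf) => _ [q Aq <-]; rewrite sublinear0 //; exact: Asub.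
- move=> t x t0; rewrite mulrC -ler_pdivrMr //; apply: (lbinf) => _ [q Aq <-].
  rewrite ler_pdivrMr //; apply: (Sinf); exists q => //.
  by rewrite (Asub _ Aq).2 1?ltW // mulrC.
Qed.

(* A minimal sublinear functional is additive, since it cannot be decreased by
   [sublinear_shift]. *)
Lemma sublinear_dominates_additive (R : realType) (V : lmodType R[i])
    (p : V -> R) :
  sublinear p -> exists q : V -> R,
    [/\ sublinear q, (forall x, q x <= p x) & (forall x y, q (x + y) = q x + q y)].
Proof.
move=> sp.
pose T := {q : V -> R | sublinear q /\ forall x, q x <= p x}.
pose mk f H : T := exist _ f H.
(* The order is reversed, so that a maximal element for [r] is a pointwise minimal functional. *)
pose r (a b : T) := `[< forall x, sval b x <= sval a x >].
have [|b a c /asboolP ba /asboolP ac|a b /asboolP ab /asboolP ba|A Atot|q qmin] :=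
    @Zorn T r.
- by move=> a; apply/asboolP.
- by apply/asboolP => x; exact: le_trans (ac x) (ba x).
- case: a b ab ba => [a Ha] [b Hb] /= ab ba.
  have E : a = b by apply/funext => x; apply/le_anti; rewrite ab ba.
  by subst b; rewrite (Prop_irrelevance Ha Hb).
(* The empty chain has no infimum to use; it is bounded by [p] itself. *)
- have [A0|/set0P[a Aa]] := eqVneq A set0.
    have pp : sublinear p /\ forall x, p x <= p x by split.
    by exists (mk _ pp) => s; rewrite A0.
  have [|||q0 sq0 q0min] := @sublinear_chain_inf R V [set sval a | a in A].
  + by move=> _ [b _ <-]; case: (svalP b).
  + by exists (sval a), a.
  + move=> _ _ [b Ab <-] [c Ac <-].
    by case: (Atot _ _ Ab Ac) => /asboolP h; [right|left].
  have q0p : sublinear q0 /\ forall x, q0 x <= p x.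
    split=> // x; apply: le_trans (q0min (sval a) _ x) _; first by exists a.
    by case: (svalP a).
  exists (mk _ q0p) => b Ab; apply/asboolP => x /=.
  by apply: (q0min); exists b.
have [sq qp] := svalP q.
exists (sval q); split=> // x y; apply/le_anti; rewrite sq.1 /=.
(* Minimality forces $q' = q$, hence $q(-y) \le -q(y)$. Writing $x = (x + y) - y$ then gives $q(x) +
   q(y) \le q(x + y)$. *)
have [q' [sq' q'q q'x]] := sublinear_shift y sq.
have q'p : sublinear q' /\ forall z, q' z <= p z.
  by split=> // z; exact: le_trans (q'q z) (qp z).
have /(congr1 sval)/= E : mk _ q'p = q by apply: qmin; exact/asboolP.
rewrite E in q'x.
have := sq.1 (x + y) (- y); rewrite addrK => h.
lra.
Qed.


(** * The real-valued norm on complex normed modules *)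

Section rnorm_theory.
Context {R : realType} {V : normedModType R[i]}.
Implicit Types x y : V.

Lemma rnormE x : (rnorm x)%:C = `|x|.
Proof. by apply: RRe_real; exact: normr_real. Qed.

Lemma rnorm_ge0 x : 0 <= rnorm x.
Proof. by rewrite -ler0c rnormE. Qed.

Lemma ler_rnormD x y : rnorm (x + y) <= rnorm x + rnorm y.
Proof. by rewrite -lecR rmorphD /= !rnormE ler_normD. Qed.

Lemma rnormZ (c : R[i]) x : rnorm (c *: x) = rnorm (c : R[i]^o) * rnorm x.
Proof. by apply: complexI; rewrite rmorphM /= !rnormE normrZ. Qed.

Lemma rnorm0 : rnorm (0 : V) = 0.
Proof. by rewrite /rnorm normr0. Qed.

Lemma rnorm_eq0 x : (rnorm x == 0) = (x == 0).
Proof. by rewrite -(inj_eq (@complexI R)) /= rnormE normr_eq0. Qed.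

End rnorm_theory.

Lemma rnormM (R : realType) (a b : R[i]) :
  rnorm (a * b : R[i]^o) = rnorm (a : R[i]^o) * rnorm (b : R[i]^o).
Proof. exact: (@rnormZ R R[i]^o). Qed.

Lemma rnorm_real (R : realType) (t : R) : rnorm (t%:C : R[i]^o) = `|t|.
Proof.
apply: complexI; rewrite rnormE.
have [t0|t0] := leP 0 t; first by rewrite [in RHS]ger0_norm // ger0_norm // ler0c.
by rewrite [in RHS]ltr0_norm // ltr0_norm ?rmorphN // ltcR.
Qed.

Lemma sublinear_rnorm (R : realType) (V : normedModType R[i]) :
  sublinear (@rnorm R V).
Proof.
split=> [x y|t x t0]; first exact: ler_rnormD.
by rewrite rnormZ rnorm_real ger0_norm.
Qed.


(* The complex functional with real part [q] is [q x - i q (i x)]. *)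
Lemma hahn_banach_norming (R : realType) (V : normedModType R[i]) (x0 : V) :
  exists phi : {linear V -> R[i]^o},
    (forall x, rnorm (phi x) <= rnorm x) /\ phi x0 = (rnorm x0)%:C.
Proof.
(* Shifting the norm along [x0] before taking an additive minorant forces every additive [q] below
   [p] to satisfy $q(x_0) = \|x_0\|$. *)
have [p [sp pn px0]] := sublinear_shift x0 (sublinear_rnorm V).
have [q [sq qp qD]] := sublinear_dominates_additive sp.
have q_le x : q x <= rnorm x by exact: le_trans (qp x) (pn x).
have q0 : q 0 = 0 by exact: sublinear0.
have qN x : q (- x) = - q x by apply: (addrI (q x)); rewrite -qD !subrr.
have qx0 : q x0 = rnorm x0.
  apply/le_anti; rewrite q_le /= -lerN2 -qN; exact: le_trans (qp _) px0.
have qZ (t : R) x : q (t%:C *: x) = t * q x.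
  have [t0|t0] := leP 0 t; first exact: sq.2.
  rewrite -[t]opprK rmorphN scaleNr qN sq.2 ?oppr_ge0 ?ltW //; ring.
pose f (x : V) : R[i]^o := q x -i* q ('i *: x).
have f_lin : linear f.
  move=> [a b] x y; rewrite /f.
  have E : (a +i* b) *: x = a%:C *: x + b%:C *: ('i *: x).
    by rewrite scalerA -scalerDl; congr (_ *: _); simpc.
  have E' : 'i *: (((a +i* b) *: x) + y) =
      a%:C *: ('i *: x) + (- b)%:C *: x + 'i *: y.
    rewrite scalerDr !scalerA -scalerDl; congr (_ *: _ + _); by simpc.
  rewrite E' E !qD !qZ; apply/eqP; rewrite eq_complex /=; apply/andP.
  by split; apply/eqP; ring.
pose phi : {linear V -> R[i]^o} :=
  HB.pack f (GRing.isLinear.Build _ _ _ _ f f_lin).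
have phi_le x : rnorm (phi x) <= rnorm x.
  have [z0|z0] := eqVneq (phi x) 0; first by rewrite z0 rnorm0 rnorm_ge0.
  have nz0 : rnorm (phi x) != 0 by rewrite rnorm_eq0.
  (* The unimodular factor [w] rotates [phi x] onto the positive real axis, where [phi] agrees with
     its real part [q], which is bounded by the norm. *)
  pose w : R[i] := (rnorm (phi x))%:C / phi x.
  have w1 : rnorm (w : R[i]^o) = 1.
    apply: complexI; rewrite rnormE normrM normfV -[`|phi x|]rnormE.
    rewrite ger0_norm ?ler0c ?rnorm_ge0 // divff //.
    by rewrite (inj_eq (@complexI R) _ 0).
  have pw : phi (w *: x) = (rnorm (phi x))%:C.
    by rewrite linearZ /= /w -[LHS]/(_ * _) divfK.
  have <- : q (w *: x) = rnorm (phi x) by have := congr1 (@complex.Re R) pw.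
  by rewrite (le_trans (q_le _)) // rnormZ w1 mul1r.
exists phi; split=> //.
(* The real part alone already attains the bound $|\varphi(x_0)| \le \|x_0\|$, so the imaginary part
   must vanish. *)
have re : complex.Re (phi x0) = rnorm x0 by rewrite -qx0.
have := phi_le x0.
rewrite -lecR (rnormE (phi x0)) [`|_|]normc_def lecR re => h.
have im : complex.Im (phi x0) = 0.
  apply/eqP; rewrite -sqrf_eq0 eq_le sqr_ge0 andbT.
  move: h; rewrite -(ler_pXn2r (n := 2)) ?nnegrE ?sqrtr_ge0 ?rnorm_ge0 //.
  by rewrite sqr_sqrtr ?addr_ge0 ?sqr_ge0 // gerDl.
by apply/eqP; rewrite eq_complex re im /= !eqxx.
Qed.

(** * Sequence norms *)

Section lpnorm_theory.
Context {R : realType}.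
Implicit Types (p : \bar R) (a b : nat -> R).
Local Open Scope ereal_scope.

Lemma lpnorm_ge0 p a : 0 <= lpnorm p a.
Proof. exact: Lnorm_ge0. Qed.

(** Only the empty set is null for the counting measure. This turns the essential supremum into a
    plain one. *)
Lemma counting_ae (P : nat -> Prop) :
  (\forall n \ae (@counting nat R), P n) -> forall n, P n.
Proof.
case=> A [_ A0 PA] n; apply: contrapT => nP.
have An : A n by apply: PA.
move: A0; rewrite /counting; case: asboolP => // finA /eqP.
rewrite eqe pnatr_eq0 finmap.cardfs_eq0 => /eqP A0.
by move: An; rewrite -(fset_setK finA) A0.
Qed.

Lemma counting_setT_gt0 : 0 < @counting nat R [set: nat].
Proof.
rewrite /counting; case: asboolP => [|_]; last by rewrite ltry.
by move/infinite_nat.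
Qed.

Lemma lpnorm_pinfty_le a M :
  lpnorm +oo a <= M <-> forall n, `|a n|%:E <= M.
Proof.
rewrite /lpnorm unlock /= counting_setT_gt0; split.
  by move/ess_supP/counting_ae.
by move=> h; apply/ess_supP; apply: nearW => n; exact: h.
Qed.

Lemma le_lpnorm p a b : 1 <= p -> (forall n, (`|a n| <= `|b n|)%R) ->
  lpnorm p a <= lpnorm p b.
Proof.
case: p => [r| |//] r1 ab; last first.
  apply/lpnorm_pinfty_le => n; apply: (@le_trans _ _ `|b n|%:E).
    by rewrite lee_fin.
  by move: n; apply/lpnorm_pinfty_le.
have r0 : (0 < r)%R by rewrite (lt_le_trans ltr01).
rewrite /lpnorm !Lnorm_counting //; apply: gt0_ler_poweR.
- by rewrite invr_ge0 ltW.
- by rewrite in_itv /= leey andbT nneseries_ge0 // => n _ _; exact: poweR_ge0.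
- by rewrite in_itv /= leey andbT nneseries_ge0 // => n _ _; exact: poweR_ge0.
- apply: lee_nneseries => [n _ _|n _]; first exact: poweR_ge0.
  by rewrite /= lee_fin ge0_ler_powR ?nnegrE // ltW.
Qed.

Lemma lpnormZ p (c : R) a : 1 <= p -> (0 < c)%R ->
  lpnorm p (fun n => c * a n)%R = c%:E * lpnorm p a.
Proof.
case: p => [r| |//] r1 c0; last first.
  rewrite /lpnorm unlock /= counting_setT_gt0 -ess_sup_pZl //.
  by congr ess_sup; apply/funext => n /=; rewrite normrM gtr0_norm.
have r0 : (0 < r)%R by rewrite (lt_le_trans ltr01).
rewrite /lpnorm !Lnorm_counting //.
under eq_eseriesr => n _ do
  rewrite /= normrM powRM // EFinM.
rewrite nneseriesZl; last by move=> n _; rewrite lee_fin powR_ge0.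
rewrite poweRM ?lee_fin ?powR_ge0 //; last first.
  by rewrite nneseries_ge0 // => n _ _; rewrite lee_fin powR_ge0.
congr (_ * _).
by rewrite /= -powRrM divff ?gt_eqF // powRr1 gtr0_norm // ltW.
Qed.

Lemma lpnorm_single p a : 1 <= p -> (forall n, a n.+1 = 0%R) ->
  lpnorm p a = `|a 0%N|%:E.
Proof.
case: p => [r| |//] r1 a0; last first.
  apply/le_anti/andP; split.
    by apply/lpnorm_pinfty_le => -[|n] //; rewrite a0 normr0 lee_fin.
  by move: 0%N; apply/lpnorm_pinfty_le.
have r0 : (0 < r)%R by rewrite (lt_le_trans ltr01).
rewrite /lpnorm Lnorm_counting // nneseries_recl //; last first.
  by move=> n _; exact: poweR_ge0.
rewrite eseries0 ?adde0; last first.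
  by case=> // n _ _; rewrite /= a0 normr0 powR0 // gt_eqF.
by rewrite /= -powRrM divff ?gt_eqF // powRr1.
Qed.

(** Finite sums suffice, because elements of a p-convex hull are limits of partial sums. The
    exponents 1 and [+oo] are estimated directly; the remaining ones reduce to Hölder's inequality
    for the counting measure. *)
Lemma ge0_lpnorm_hoelder p a b n : 1 <= p ->
  (\sum_(0 <= k < n) `|a k| * `|b k|)%:E <=
  lpnorm (hoelder_conjugate p) a * lpnorm p b.
Proof.
have L1 (c : nat -> R) : \sum_(0 <= k <oo) `|c k|%:E = lpnorm 1 c.
  rewrite /lpnorm Lnorm_counting // invr1 poweRe1.
    by apply: eq_eseriesr => k _; rewrite /= powRr1.
  by apply: nneseries_ge0 => k _ _; exact: poweR_ge0.
have partial (c : nat -> R) : (\sum_(0 <= k < n) `|c k|)%:E <= lpnorm 1 c.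
  by rewrite -sumEFin -L1; apply: nneseries_lim_ge => k _; rewrite lee_fin.
have sup (c : nat -> R) k : `|c k|%:E <= lpnorm +oo c.
  by move: k; apply/lpnorm_pinfty_le.
have ext (c d : nat -> R) :
    (\sum_(0 <= k < n) `|c k| * `|d k|)%:E <= lpnorm 1 c * lpnorm +oo d.
  (* With an infinite supremum the right side is [+oo], except when [lpnorm 1 c] is 0: then the
     convention $0 \cdot \infty = 0$ makes it 0, but all [c k] vanish as well. *)
  have [->|doo] := eqVneq (lpnorm +oo d) +oo.
    have [c0|c0] := eqVneq (lpnorm 1 c) 0.
      rewrite c0 mul0e lee_fin big1_seq // => k /=; rewrite mem_index_iota => kn.
      have -> : (`|c k| = 0)%R; last by rewrite mul0r.
      apply/le_anti; rewrite normr_ge0 andbT -lee_fin.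
      rewrite (_ : 0%:E = lpnorm 1 c) // -L1.
      apply: le_trans (nneseries_lim_ge k.+1 _) => //.
      by rewrite big_nat_recr //= leeDr // sume_ge0.
    by rewrite gt0_muley ?leey // lt_def c0 lpnorm_ge0.
  have dfin : lpnorm +oo d \is a fin_num.
    by rewrite ge0_fin_numE ?lpnorm_ge0 // ltey.
  apply: (@le_trans _ _ ((\sum_(0 <= k < n) `|c k|)%:E * lpnorm +oo d)); last first.
    by apply: lee_wpmul2r => //; exact: lpnorm_ge0.
  rewrite -(fineK dfin) -EFinM lee_fin mulr_suml.
  apply: ler_sum => k _; apply: ler_wpM2l => //.
  by rewrite -lee_fin fineK.
case: p => [r| |//] r1; last first.
  by rewrite hoelder_conjugatey; exact: ext.
have [->|r1'] := eqVneq r 1%R.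
  rewrite hoelder_conjugate1 muleC.
  by under eq_bigr do rewrite mulrC; exact: ext.
have {r1 r1'}r1 : (1 < r)%R by rewrite lt_def r1' -lee_fin.
have r0 : (0 < r)%R by rewrite (lt_trans ltr01).
have -> : hoelder_conjugate r%:E = (r / (r - 1))%:E.
  by rewrite /hoelder_conjugate /= eqe gt_eqF // -EFinB inver subr_eq0 gt_eqF.
apply: (@le_trans _ _ (lpnorm 1 (a \* b)%R)).
  apply: le_trans (partial _); rewrite lee_fin.
  by apply: ler_sum => k _; rewrite normrM.
apply: hoelder => //; first by rewrite divr_gt0 // subr_gt0.
rewrite invf_div; field; exact: lt0r_neq0.
Qed.

End lpnorm_theory.

(** * Scaling and functionals on p-convex hulls *)

Lemma bounded_by_rnorm_continuous (R : realType) (V W : normedModType R[i])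
    (T : {linear V -> W}) (M : R) :
  0 <= M -> (forall x, rnorm (T x) <= M * rnorm x) -> continuous T.
Proof.
move=> M0 TM; apply: bounded_linear_continuous; apply/bounded_funP => r.
(* The radius [r] is an arbitrary element of [R[i]] when the bound is chosen, hence the modulus; a
   point with norm at most [r] then makes [r] real and nonnegative. *)
exists (M%:C * `|r|) => x xr; rewrite -rnormE.
have /RRe_real rE : `|r| \is Num.real by exact: normr_real.
rewrite -rE -rmorphM lecR (le_trans (TM x)) //.
have xr' : rnorm x <= complex.Re `|r|.
  rewrite -lecR rE rnormE (le_trans xr) // real_ler_norm //.
  by rewrite (ger0_real (le_trans _ xr)).
by rewrite ler_wpM2l.
Qed.

Lemma continuous_linear_rnorm_bound (R : realType) (V W : normedModType R[i])
    (T : {linear V -> W}) :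
  continuous T -> exists2 M : R, 0 < M & forall x, rnorm (T x) <= M * rnorm x.
Proof.
move=> /linear_bounded_continuous/linear_boundedP/pinfty_ex_gt0[M M0 TM].
have ME : (complex.Re M)%:C = M by apply: RRe_real; exact: gtr0_real.
exists (complex.Re M); first by rewrite -ltcR ME.
by move=> x; rewrite -lecR rmorphM /= ME !rnormE.
Qed.

(** Dividing a nonzero vector by its norm extends the bound from the unit ball to the whole space;
    conversely, the global bound yields continuity. *)
Lemma dual_ballP (R : realType) (V : normedModType R[i])
    (phi : {linear V -> R[i]^o}) :
  dual_ball phi <-> forall x, rnorm (phi x) <= rnorm x.
Proof.
split=> [[_ phi1] x|phi1]; last first.
  split; last by move=> x x1; exact: le_trans (phi1 x) x1.
  by apply: (@bounded_by_rnorm_continuous _ _ _ _ 1) => // x; rewrite mul1r.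
have [->|x0] := eqVneq x 0; first by rewrite linear0 !rnorm0.
have nx0 : 0 < rnorm x by rewrite lt_def rnorm_eq0 x0 rnorm_ge0.
have nxV : rnorm ((rnorm x)^-1%:C : R[i]^o) = (rnorm x)^-1.
  by rewrite rnorm_real ger0_norm // invr_ge0 ltW.
have := phi1 ((rnorm x)^-1%:C *: x).
rewrite linearZ /= rnormM nxV ler_pdivrMl // mulr1; apply.
by rewrite /unit_ball /= rnormZ nxV mulVf // gt_eqF.
Qed.

(** * Positive multiples of sequences and of their hulls *)

Section scaling.
Context {R : realType} {V : normedModType R[i]}.
Implicit Types (p : \bar R) (i : seq_kind) (x : nat -> V) (c : R).

Lemma rnormZ_gt0 (W : normedModType R[i]) c (y : W) :
  0 < c -> rnorm (c%:C *: y) = c * rnorm y.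
Proof. by move=> c0; rewrite rnormZ rnorm_real gtr0_norm. Qed.

Lemma pconvZ p x (y : V) (c : R[i]) :
  pconv p x y -> pconv p (fun n => c *: x n) (c *: y).
Proof.
case=> a a1 ay; exists a => //.
have -> : series (fun n => a n *: (c *: x n)) =
    c \*: series (fun n => a n *: x n).
  apply/funext => n; rewrite /series /= scaler_sumr.
  by apply: eq_bigr => k _; rewrite !scalerA mulrC.
exact: cvgZl_tmp.
Qed.

Lemma strong_normZ p x c : (1 <= p)%E -> 0 < c ->
  strong_norm p (fun n => c%:C *: x n) = (c%:E * strong_norm p x)%E.
Proof.
move=> p1 c0; rewrite /strong_norm -lpnormZ //.
by congr lpnorm; apply/funext => n; rewrite rnormZ_gt0.
Qed.

Lemma lpnorm_functionalZ p (phi : {linear V -> R[i]^o}) x c :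
  (1 <= p)%E -> 0 < c ->
  lpnorm p (fun n => rnorm (phi (c%:C *: x n))) =
    (c%:E * lpnorm p (fun n => rnorm (phi (x n))))%E.
Proof.
move=> p1 c0; rewrite -lpnormZ //.
by congr lpnorm; apply/funext => n; rewrite linearZ rnormZ_gt0.
Qed.

Lemma weak_normZ p x c : (1 <= p)%E -> 0 < c ->
  weak_norm p (fun n => c%:C *: x n) = (c%:E * weak_norm p x)%E.
Proof.
move=> p1 c0; rewrite /weak_norm; case: ifP => _.
  rewrite -ereal_sup_pZl // image_comp; congr ereal_sup.
  by apply: eq_imagel => n _; rewrite /= rnormZ_gt0 // EFinM.
rewrite -ereal_sup_pZl // image_comp; congr ereal_sup.
by apply: eq_imagel => phi _; rewrite /= lpnorm_functionalZ.
Qed.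

Lemma seq_normZ p i x c : (1 <= p)%E -> 0 < c ->
  seq_norm p i (fun n => c%:C *: x n) = (c%:E * seq_norm p i x)%E.
Proof. by case: i; [exact: strong_normZ|exact: weak_normZ..]. Qed.

Lemma strong_seqZ p x c : (1 <= p)%E -> 0 < c -> strong_seq p x ->
  strong_seq p (fun n => c%:C *: x n).
Proof.
move=> p1 c0; rewrite /strong_seq; case: ifP => _ xp.
  by rewrite -(scaler0 _ c%:C); exact: cvgZl_tmp.
by rewrite strong_normZ // lte_mul_pinfty // lee_fin ltW.
Qed.

Lemma weak_seqZ p x c : (1 <= p)%E -> 0 < c -> weak_seq p x ->
  weak_seq p (fun n => c%:C *: x n).
Proof.
move=> p1 c0 xp phi /xp; case: ifP => _ xphi.
  have -> : (fun n => phi (c%:C *: x n)) = c%:C \*: (phi \o x).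
    by apply/funext => n /=; rewrite linearZ.
  by rewrite -(scaler0 R[i]^o c%:C); exact: cvgZl_tmp.
by rewrite lpnorm_functionalZ // lte_mul_pinfty // lee_fin ltW.
Qed.

Lemma uncond_seqZ p x c : (1 <= p)%E -> 0 < c -> uncond_seq p x ->
  uncond_seq p (fun n => c%:C *: x n).
Proof.
move=> p1 c0; rewrite /uncond_seq; case: ifP => _.
  by move=> xp; rewrite -(scaler0 _ c%:C); exact: cvgZl_tmp.
case=> xw xt; split; first exact: weak_seqZ.
under eq_fun do rewrite weak_normZ //.
by rewrite -(mule0 c%:E); exact: cvgeZl.
Qed.

Lemma seq_of_kindZ p i x c : (1 <= p)%E -> 0 < c -> seq_of_kind p i x ->
  seq_of_kind p i (fun n => c%:C *: x n).
Proof.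
by case: i; [exact: strong_seqZ|exact: weak_seqZ|exact: uncond_seqZ].
Qed.

(** Serves to pass from the image of the unit ball under an operator to a weighted image contained
    in a multiple of it. *)
Lemma hull_seqsZ p i (K L : set V) x c : (1 <= p)%E -> 0 < c ->
  L `<=` [set c%:C *: y | y in K] -> hull_seqs p i K x ->
  hull_seqs p i L (fun n => c%:C *: x n).
Proof.
move=> p1 c0 LK [xi Kx]; split; first exact: seq_of_kindZ.
by move=> _ /LK[y Ky <-]; apply: pconvZ; exact: Kx.
Qed.

End scaling.

(** * Functionals as lower bounds for hull norms *)

Section lower_bound.
Context {R : realType} {V : normedModType R[i]}.
Implicit Types (p : \bar R) (i : seq_kind) (x : nat -> V).

(** Hölder's inequality bounds [phi] on every partial sum, and some partial sum lies within [e] of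
    [y]. *)
Lemma pconv_functional_le p x (y : V) (phi : {linear V -> R[i]^o}) :
  (1 <= p)%E -> dual_ball phi -> pconv p x y ->
  ((rnorm (phi y))%:E <= lpnorm p (fun n => rnorm (phi (x n))))%E.
Proof.
move=> p1 /dual_ballP phi1 [a a1 ay]; apply/lee_addgt0Pr => e e0.
have eC : 0 < e%:C by rewrite ltcR.
have /cvgrPdist_lt/(_ _ eC)[n _ /(_ n (leqnn n)) yn] := ay.
rewrite -rnormE ltcR in yn.
set s := series _ n in yn.
apply: (@le_trans _ _ ((rnorm (phi s))%:E + e%:E)%E).
  rewrite -EFinD lee_fin -{1}(subrK s y) linearD (le_trans (ler_rnormD _ _)) //.
  by rewrite addrC lerD2l (le_trans (phi1 _)) // ltW.
apply: leeD2r.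
apply: (@le_trans _ _
    (lpnorm (hoelder_conjugate p) (fun n => rnorm (a n : R[i]^o)) *
    lpnorm p (fun n => rnorm (phi (x n))))%E); last first.
  by rewrite -[leRHS]mul1e; apply: lee_wpmul2r => //; exact: lpnorm_ge0.
apply: le_trans (ge0_lpnorm_hoelder _ _ n p1); rewrite lee_fin.
rewrite /s /series /= linear_sum /=.
elim: n {yn s} => [|n IH]; first by rewrite !big_nil rnorm0.
rewrite !big_nat_recr //= (le_trans (ler_rnormD _ _)) // lerD //.
by rewrite linearZ /= rnormZ !ger0_norm // rnorm_ge0.
Qed.

(** For finite [p] the weak norm is a supremum over such [phi]; the strong norm and the weak norm at
    [+oo] dominate term by term. *)
Lemma lpnorm_functional_le_seq_norm p i x (phi : {linear V -> R[i]^o}) :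
  (1 <= p)%E -> dual_ball phi ->
  (lpnorm p (fun n => rnorm (phi (x n))) <= seq_norm p i x)%E.
Proof.
move=> p1 phi1; have /dual_ballP phi_le := phi1.
have weak : (lpnorm p (fun n => rnorm (phi (x n))) <= weak_norm p x)%E.
  rewrite /weak_norm; case: eqVneq => [->|_]; last first.
    by apply: ereal_sup_ubound; exists phi.
  apply/lpnorm_pinfty_le => n; rewrite ger0_norm ?rnorm_ge0 //.
  apply: (@le_trans _ _ (rnorm (x n))%:E); first by rewrite lee_fin.
  by apply: ereal_sup_ubound; exists n.
case: i => //; apply: le_lpnorm => // n.
by rewrite !ger0_norm ?rnorm_ge0.
Qed.

Lemma functional_le_hull_norm p i (K : set V) (y : V)
    (phi : {linear V -> R[i]^o}) : (1 <= p)%E -> dual_ball phi -> K y ->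
  ((rnorm (phi y))%:E <= hull_norm p i K)%E.
Proof.
move=> p1 phi1 Ky; apply/ereal_infP => _ [x [_ Kx] <-].
apply: le_trans (lpnorm_functional_le_seq_norm i x p1 phi1).
by apply: pconv_functional_le => //; exact: Kx.
Qed.

(** Any member of the dual ball puts an [lpnorm] below [seq_norm]; the Hahn-Banach theorem at 0
    supplies one. *)
Lemma hull_norm_ge0 p i (K : set V) : (1 <= p)%E -> (0 <= hull_norm p i K)%E.
Proof.
move=> p1; apply/ereal_infP => _ [x _ <-].
have [phi [phi_le _]] := hahn_banach_norming (0 : V).
have phi1 : dual_ball phi by apply/dual_ballP.
apply: le_trans (lpnorm_functional_le_seq_norm i x p1 phi1).
exact: lpnorm_ge0.
Qed.

End lower_bound.

(** * One-term sequences and rank-one operators *)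

Section rank_one.
Context {R : realType} {V : normedModType R[i]}.
Implicit Types (p : \bar R) (i : seq_kind) (u : V).

Definition single_seq u (n : nat) : V := if n is 0%N then u else 0.

Lemma lpnorm_single_functional p u (phi : {linear V -> R[i]^o}) : (1 <= p)%E ->
  lpnorm p (fun n => rnorm (phi (single_seq u n))) = (rnorm (phi u))%:E.
Proof.
move=> p1; rewrite lpnorm_single //= ?ger0_norm ?rnorm_ge0 //.
by move=> n; rewrite linear0 rnorm0.
Qed.

Lemma strong_norm_single p u : (1 <= p)%E ->
  strong_norm p (single_seq u) = (rnorm u)%:E.
Proof.
move=> p1; rewrite /strong_norm lpnorm_single //= ?ger0_norm ?rnorm_ge0 //.
by move=> n; rewrite rnorm0.
Qed.

Lemma weak_norm_single_le p u : (1 <= p)%E ->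
  (weak_norm p (single_seq u) <= (rnorm u)%:E)%E.
Proof.
move=> p1; rewrite /weak_norm; case: ifP => _; apply/ereal_supP => y.
  by move=> [[|n] _ <-] //=; rewrite lee_fin rnorm0 rnorm_ge0.
move=> [phi /dual_ballP phi1 <-].
by rewrite lpnorm_single_functional // lee_fin.
Qed.

Lemma single_seq_cvg0 (W : normedModType R[i]) (x : nat -> W) :
  (forall n, x n.+1 = 0) -> x @ \oo --> (0 : W).
Proof.
move=> x0; apply: cvg_near_cst.
by exists 1%N => // -[|n].
Qed.

Lemma weak_seq_single p u : (1 <= p)%E -> weak_seq p (single_seq u).
Proof.
move=> p1 phi _; case: ifP => _; last by rewrite lpnorm_single_functional ?ltry.
by apply: single_seq_cvg0 => n /=; rewrite linear0.
Qed.

Lemma seq_of_kind_single p i u : (1 <= p)%E -> seq_of_kind p i (single_seq u).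
Proof.
move=> p1; case: i => /=; last first.
- rewrite /uncond_seq; case: ifP => _; first exact: single_seq_cvg0.
  split; first exact: weak_seq_single.
  (* From index 1 on, every tail is the zero sequence, rewritten as [single_seq 0] so that the
     one-term bound applies. *)
  apply: cvg_near_cst; exists 1%N => // -[|m] // _.
  have -> : (fun n => single_seq u (m.+1 + n)) = single_seq 0.
    by apply/funext => -[|n].
  apply/le_anti/andP; split.
    by have := weak_norm_single_le 0 p1; rewrite rnorm0.
  have [phi [phi_le _]] := hahn_banach_norming (0 : V).
  have phi1 : dual_ball phi by apply/dual_ballP.
  apply: le_trans (lpnorm_functional_le_seq_norm WeakSeq _ p1 phi1).
  exact: lpnorm_ge0.
- exact: weak_seq_single.
- rewrite /strong_seq; case: ifP => _; first exact: single_seq_cvg0.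
  by rewrite strong_norm_single // ltry.
Qed.

Lemma seq_norm_single_le p i u : (1 <= p)%E ->
  (seq_norm p i (single_seq u) <= (rnorm u)%:E)%E.
Proof.
by case: i => p1 /=; [rewrite strong_norm_single|exact: weak_norm_single_le..].
Qed.

Lemma pconv_single p u (b : R[i]) : (1 <= p)%E -> rnorm (b : R[i]^o) <= 1 ->
  pconv p (single_seq u) (b *: u).
Proof.
move=> p1 b1; exists (fun n => if n is 0%N then b else 0).
  rewrite lpnorm_single ?hoelder_conj_ge1 //=; last first.
    by move=> n; rewrite /rnorm normr0.
  by rewrite lee_fin ger0_norm // (@rnorm_ge0 R R[i]^o).
(* [series] at [n] sums the indices below [n], so the partial sums equal [b *: u] from [n = 1]
   on. *)
apply: cvg_near_cst; exists 1%N => // -[|n] // _.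
rewrite /series /= big_nat_recl //= big1 ?addr0 // => k _.
by rewrite scale0r.
Qed.

(** Test operators for the lower bound: the unit ball goes to multiples [b *: u] with $|b| \le 1$,
    which lie in the hull of a one-term sequence for each of the three kinds. *)
Lemma rank_one_compact_op p i (phi : {linear V -> R[i]^o}) u : (1 <= p)%E ->
    dual_ball phi -> rnorm u <= 1 ->
  exists A : {linear V -> V}, [/\ forall x, A x = phi x *: u,
    compact_op p i A & (compact_op_norm p i A <= 1)%E].
Proof.
move=> p1 /dual_ballP phi1 u1.
pose f x : V := phi x *: u.
have f_lin : linear f.
  by move=> a x y; rewrite /f linearP scalerDl -scalerA.
pose A : {linear V -> V} := HB.pack f (GRing.isLinear.Build _ _ _ _ f f_lin).
have hA : hull_seqs p i (A @` @unit_ball R V) (single_seq u).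
  split; first exact: seq_of_kind_single.
  by move=> _ [x x1 <-]; apply: pconv_single => //; exact: le_trans (phi1 x) x1.
exists A; split=> //.
  split; last by exists (single_seq u).
  apply: (@bounded_by_rnorm_continuous _ _ _ _ 1) => // x.
  rewrite /= /f rnormZ mul1r.
  by rewrite -[leRHS]mulr1 ler_pM ?rnorm_ge0.
apply: (@le_trans _ _ (seq_norm p i (single_seq u))).
  by apply: ereal_inf_lbound; exists (single_seq u).
by rewrite (le_trans (seq_norm_single_le _ _ p1)) // lee_fin.
Qed.

End rank_one.


(** * The weighted supremum norm against the quotient norm *)

Section weighted_bounds.
Context {R : realType} {E : completeNormedModType R[i]}.
Variables (U : set E) (v : E -> R).
Hypothesis v_gt0 : forall x, U x -> 0 < v x.
Implicit Types (p : \bar R) (i : seq_kind) (F G : completeNormedModType R[i]).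

Lemma Hv_norm_ge F (f : E -> F) x : U x ->
  ((v x * rnorm (f x))%:E <= Hv_norm U v f)%E.
Proof. by move=> Ux; apply: ereal_sup_ubound; right; exists x. Qed.

Lemma Hv_norm_ge0 F (f : E -> F) : (0 <= Hv_norm U v f)%E.
Proof. by apply: ereal_sup_ubound; left. Qed.

Lemma Hv_comp F G (A : {linear F -> G}) (f : E -> F) :
  continuous A -> Hv U v f -> Hv U v (A \o f).
Proof.
move=> Ac [df fv]; split.
  move=> x Ux; apply: differentiable_comp; first exact: df.
  exact: linear_differentiable.
have [M M0 AM] := continuous_linear_rnorm_bound Ac.
apply: (@le_lt_trans _ _ (M%:E * Hv_norm U v f)%E); last first.
  by rewrite lte_mul_pinfty // lee_fin ltW.
apply/ereal_supP => _ [->|[x Ux <-]].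
  by rewrite mule_ge0 ?Hv_norm_ge0 // lee_fin ltW.
apply: (@le_trans _ _ (M%:E * (v x * rnorm (f x))%:E)%E).
  rewrite -EFinM lee_fin mulrCA ler_wpM2l ?AM // ltW //; exact: v_gt0.
by apply: lee_wpmul2l; [rewrite lee_fin ltW|exact: Hv_norm_ge].
Qed.

Lemma weighted_image_comp_sub F G (A : {linear F -> G}) (f : E -> F) (c : R) :
  0 < c -> (Hv_norm U v f <= c%:E)%E ->
  weighted_image U v (A \o f) `<=` [set c%:C *: y | y in A @` @unit_ball R F].
Proof.
move=> c0 fc _ [x Ux <-].
have vx := v_gt0 Ux.
(* The preimage $v(x) f(x) / c$ lies in the unit ball because $v(x) \|f(x)\| \le \|f\|_v \le c$. *)
exists (A ((v x / c)%:C *: f x)); last first.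
  by rewrite linearZ /= scalerA -rmorphM /= mulrC divfK // gt_eqF.
exists ((v x / c)%:C *: f x) => //; rewrite /unit_ball /=.
rewrite rnormZ_gt0 ?divr_gt0 // mulrAC ler_pdivrMr // mul1r -lee_fin.
exact: le_trans (Hv_norm_ge f Ux) fc.
Qed.

Lemma HvK_comp F G p i (A : {linear F -> G}) (f : E -> F) : (1 <= p)%E ->
  compact_op p i A -> Hv U v f -> HvK U v p i (A \o f).
Proof.
move=> p1 [Ac [x Ax]] fv; split; first exact: Hv_comp.
have fE : (fine (Hv_norm U v f))%:E = Hv_norm U v f.
  by rewrite fineK // ge0_fin_numE ?Hv_norm_ge0 //; case: fv.
(* Here only the existence of a hull sequence matters; adding 1 keeps [c] positive even when the
   norm of [f] is 0. *)
pose c := fine (Hv_norm U v f) + 1.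
have c0 : 0 < c by rewrite ltr_wpDl // fine_ge0 // Hv_norm_ge0.
exists (fun n => c%:C *: x n); apply: (hull_seqsZ p1 c0 _ Ax).
by apply: weighted_image_comp_sub => //; rewrite -fE lee_fin lerDl.
Qed.

Lemma HvK_norm_comp_le F G p i (A : {linear F -> G}) (f : E -> F) :
  (1 <= p)%E -> Hv U v f -> (compact_op_norm p i A <= 1)%E ->
  (HvK_norm U v p i (A \o f) <= Hv_norm U v f)%E.
Proof.
move=> p1 [_ fv] A1.
have fE : (fine (Hv_norm U v f))%:E = Hv_norm U v f.
  by rewrite fineK // ge0_fin_numE ?Hv_norm_ge0.
set h := fine _ in fE.
have h0 : 0 <= h by rewrite fine_ge0 // Hv_norm_ge0.
(* A hull sequence for [A] of norm below [d] exists since $\|A\| \le 1 < d$; multiplied by [c], it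
   serves for [A \o f]. *)
have scaled c d : 0 < c -> h <= c -> 1 < d ->
    (HvK_norm U v p i (A \o f) <= (c * d)%:E)%E.
  move=> c0 hc d1.
  have /ereal_inf_ltP[_ [x Ax <-] xd] : (compact_op_norm p i A < d%:E)%E.
    by rewrite (le_lt_trans A1) // lte_fin.
  have fc : (Hv_norm U v f <= c%:E)%E by rewrite -fE lee_fin.
  apply: (@le_trans _ _ (seq_norm p i (fun n => c%:C *: x n))).
    apply: ereal_inf_lbound; exists (fun n => c%:C *: x n) => //.
    exact: (hull_seqsZ p1 c0 (weighted_image_comp_sub c0 fc) Ax).
  by rewrite seq_normZ // EFinM; apply: lee_wpmul2l; rewrite ?lee_fin ltW.
apply/lee_addgt0Pr => e e0; rewrite -fE -EFinD.
(* With $c = h + e/2$, positive even for $h = 0$, and $d = (h + e)/(h + e/2) > 1$, the product $cd$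
   is exactly $h + e$. *)
have c0 : 0 < h + e / 2 by lra.
apply: le_trans (scaled (h + e / 2) ((h + e) / (h + e / 2)) c0 _ _) _.
- lra.
- by rewrite ltr_pdivlMr //; lra.
- by rewrite lee_fin mulrC divfK // gt_eqF.
Qed.

Lemma quotient_norm_ge F p i (f : E -> F) : (1 <= p)%E ->
  (Hv_norm U v f <= quotient_norm U v p i f)%E.
Proof.
(* The value 0 adjoined to the supremum in [Hv_norm] is handled first: the operator with [u = 0] is
   admissible and its hull norm is nonnegative. This covers an empty [U]. *)
move=> p1; apply/ereal_supP => y [->|[x Ux <-]].
  have [phi [phi_le _]] := hahn_banach_norming (0 : F).
  have phi1 : dual_ball phi by apply/dual_ballP.
  have [|A [_ Ak A1]] := rank_one_compact_op i (u := 0 : F) p1 phi1.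
    by rewrite rnorm0 ler01.
  apply: (@le_trans _ _ (HvK_norm U v p i (A \o f))).
    exact: hull_norm_ge0.
  by apply: ereal_sup_ubound; exists F, A.
have vx := v_gt0 Ux.
have [phi [phi_le phix]] := hahn_banach_norming (f x).
have phi1 : dual_ball phi by apply/dual_ballP.
have nV : rnorm ((rnorm (f x))^-1%:C : R[i]^o) = (rnorm (f x))^-1.
  by rewrite rnorm_real ger0_norm // invr_ge0 rnorm_ge0.
(* [u = 0] when [f x = 0], since [0^-1 = 0] *)
pose u := (rnorm (f x))^-1%:C *: f x.
have phiu : rnorm (f x) * rnorm (phi u) = rnorm (f x).
  rewrite linearZ /= rnormM nV phix rnorm_real ger0_norm ?rnorm_ge0 //.
  have [->|n0] := eqVneq (rnorm (f x)) 0; first by rewrite mul0r.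
  by rewrite mulVf // mulr1.
have [|A [AE Ak A1]] := rank_one_compact_op i (u := u) p1 phi1.
  rewrite rnormZ nV; have [->|n0] := eqVneq (rnorm (f x)) 0.
    by rewrite mulr0 ler01.
  by rewrite mulVf.
apply: (@le_trans _ _ (HvK_norm U v p i (A \o f))); last first.
  by apply: ereal_sup_ubound; exists F, A.
(* Since $A(f(x)) = \|f(x)\| u$, applying [phi] gives modulus $v(x) \|f(x)\| |\varphi(u)|$, and
   [phiu] absorbs the last factor, also when $f(x) = 0$. *)
have -> : v x * rnorm (f x) = rnorm (phi ((v x)%:C *: (A \o f) x)).
  rewrite linearZ /= rnormZ_gt0 // AE linearZ /= rnormM phix.
  by rewrite rnorm_real ger0_norm ?rnorm_ge0 // phiu.
by apply: functional_le_hull_norm => //; exists x.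
Qed.

End weighted_bounds.

Theorem mainTheorem4 (R : realType) (p : \bar R) (hp : (1 <= p)%E)
    (i : seq_kind) (E : completeNormedModType R[i]) (U : set E) (hU : open U)
    (v : E -> R) (hv : weight U v) (F : completeNormedModType R[i]) :
  quotient_Hv U v p i = Hv U v :> set (E -> F) /\
  (forall f : E -> F, Hv U v f -> quotient_norm U v p i f = Hv_norm U v f).
Proof.
have v_gt0 := hv.2; split.
  apply/seteqP; split=> f; first by case.
  by move=> fv; split=> // G A Ak; exact: HvK_comp.
move=> f fv; apply/le_anti; rewrite quotient_norm_ge // andbT.
apply/ereal_supP => _ [G [A [_ A1 ->]]].
exact: HvK_norm_comp_le.
Qed.
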